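(* Let $N=\{1,\dots,n\}$, let $\mathcal{F}\subseteq 2^N$ be downward closed, and let $a=(a_i)_{i\in N}$, $b=(b_i)_{i\in N\cup\{0\}}$ be real vectors with $a_i\ge 0$ and $b_i>0$ for all $i\in N$. If $b_0>0$, then the set function $h(\cdot;a,b)$ is submodular over $\mathcal{F}$ if and only if $$h(S\cup\{i\};a,b)+h(S\cup\{j\};a,b)\le \frac{a_i}{b_i}+\frac{a_j}{b_j}$$ for all $S\subseteq N$ and all $i,j\in N\setminus S$ with $i\ne j$ such that $S\cup\{i\}\cup\{j\}\in\mathcal{F}$.
   Context: For $S\subseteq N$, $h(S;a,b):=\dfrac{\sum_{i\in S}a_i}{b_0+\sum_{i\in S}b_i}$. A family $\mathcal{F}\subseteq 2^N$ is downward closed if $S\in\mathcal{F}$ and $T\subseteq S$ imply $T\in\mathcal{F}$. A set function $f:2^N\to\mathbb{R}$ is submodular over $\mathcal{F}$ if $f(S\cup\{i\})-f(S)\ge f(T\cup\{i\})-f(T)$ for all $i\in N$ and all $S\subseteq T\subseteq N\setminus\{i\}$ such that $T\cup\{i\}\in\mathcal{F}$. *)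

(* Defs.v *)
From mathcomp Require Import all_boot all_order all_algebra.

Set Implicit Arguments.
Unset Strict Implicit.
Unset Printing Implicit Defensive.

Import Order.TTheory GRing.Theory Num.Theory.
Local Open Scope ring_scope.

(* The ground set N = {1, ..., n} is 'I_n, the ordinal i standing for i.+1,
   and N u {0} is 'I_n.+1: the index 0 is ord0, and the element of N encoded
   by i : 'I_n sits in N u {0} as lift ord0 i, whose value is i.+1. *)

Definition h (R : realFieldType) (n : nat) (a : 'I_n -> R) (b : 'I_n.+1 -> R)
    (S : {set 'I_n}) : R :=
  (\sum_(i in S) a i) / (b ord0 + \sum_(i in S) b (lift ord0 i)).

Definition downward_closed (N : finType) (F : {set {set N}}) : Prop :=
  forall S T : {set N}, S \in F -> T \subset S -> T \in F.

Definition submodular_over (R : realFieldType) (N : finType)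
    (F : {set {set N}}) (f : {set N} -> R) : Prop :=
  forall (i : N) (S T : {set N}),
    S \subset T -> T \subset [set: N] :\ i -> T :|: [set i] \in F ->
    f (S :|: [set i]) - f S >= f (T :|: [set i]) - f T.

(* Main.v *)
(* Over a downward closed family, submodularity only has to be checked when T
   is S with one point added. For such S and T = S u {j}, the difference of the
   two marginal values of h at i is a positive multiple of
   a_i/b_i + a_j/b_j - h(S u {i}) - h(S u {j}). *)
Require Import Defs.
From mathcomp Require Import all_boot all_order all_algebra.
From mathcomp Require Import ring.
Import Order.TTheory GRing.Theory Num.Theory.
Local Open Scope ring_scope.

(** Removing from [T] a point [j] outside [S] can only raise the marginal value of [i], by the local
    inequality at [T :\ j]; repeating this shrinks [T] to [S]. Downward closure keeps each [T :\ j
    :|: [set i]] in [F]. *)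
Lemma submodular_over_local (R : realFieldType) (N : finType)
    (F : {set {set N}}) (f : {set N} -> R) :
  downward_closed F ->
  submodular_over F f <->
  (forall (S : {set N}) (i j : N),
     i \notin S -> j \notin S -> i != j -> S :|: [set i] :|: [set j] \in F ->
     f (S :|: [set i] :|: [set j]) - f (S :|: [set j])
       <= f (S :|: [set i]) - f S).
Proof.
move=> hF; split=> [fsub S i j iS jS ij SijF | floc i S T].
  (* The larger set is [S :|: [set j]], so [i] must be the point added last. *)
  rewrite setUAC; apply: fsub; first exact: subsetUl.
    by rewrite subsetD1 subsetT !inE negb_or iS ij.
  by rewrite setUAC.
move: {2}#|T| (leqnn #|T|) => m; elim: m T => [|m IHm] T leTm sST sTi TiF.
  move: leTm; rewrite leqn0 cards_eq0 => /eqP T0; move: sST.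
  by rewrite T0 subset0 => /eqP->.
have [->//|neqST] := eqVneq S T.
have /properP[_ [j jT jS]] : S \proper T by rewrite properEneq neqST.
have iT : i \notin T by move: sTi; rewrite subsetD1 => /andP[].
have TjU : (T :\ j) :|: [set j] = T by rewrite setUC setD1K.
have TijU : (T :\ j) :|: [set i] :|: [set j] = T :|: [set i].
  by rewrite setUAC TjU.
apply: le_trans (IHm (T :\ j) _ _ _ _).
- have: f (T :\ j :|: [set i] :|: [set j]) - f (T :\ j :|: [set j])
       <= f (T :\ j :|: [set i]) - f (T :\ j).
    apply: floc; rewrite ?TijU ?in_setD1 ?eqxx ?(negPf iT) ?andbF //.
    by apply: contraNneq iT => ->.
  by rewrite TijU TjU.
- by rewrite (cardsD1 j T) jT in leTm.
- by rewrite subsetD1 sST.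
- exact: subset_trans (subD1set _ _) sTi.
- by apply: hF TiF _; rewrite setSU ?subD1set.
Qed.

(** Put X = (A + ai) / (B + bi) and Y = (A + aj) / (B + bj). The marginal values are (ai - bi X) / B
    and (ai - bi Y) / (B + bi + bj); over a common denominator, X (B + bi) = A + ai and Y (B + bj) =
    A + aj leave the numerator ai bj + aj bi - bi bj (X + Y). *)
Lemma ratio_second_difference (R : realFieldType) (A B ai aj bi bj : R) :
  0 < B -> 0 < bi -> 0 < bj ->
  (A + ai) / (B + bi) - A / B
    - ((A + ai + aj) / (B + bi + bj) - (A + aj) / (B + bj)) =
  bi * bj / (B * (B + bi + bj)) *
    (ai / bi + aj / bj - ((A + ai) / (B + bi) + (A + aj) / (B + bj))).
Proof.
move=> B0 bi0 bj0; field.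
by rewrite !lt0r_neq0 // !addr_gt0.
Qed.

Theorem theorem1 (R : realFieldType) (n : nat) (F : {set {set 'I_n}})
    (a : 'I_n -> R) (b : 'I_n.+1 -> R)
    (hF : downward_closed F)
    (ha : forall i : 'I_n, 0 <= a i)
    (hb : forall i : 'I_n, 0 < b (lift ord0 i))
    (hb0 : 0 < b ord0) :
  submodular_over F (h a b) <->
  (forall (S : {set 'I_n}) (i j : 'I_n),
     i \notin S -> j \notin S -> i != j ->
     S :|: [set i] :|: [set j] \in F ->
     h a b (S :|: [set i]) + h a b (S :|: [set j]) <=
       a i / b (lift ord0 i) + a j / b (lift ord0 j)).
Proof.
have sumU1 (c : 'I_n -> R) (S : {set 'I_n}) (k : 'I_n) : k \notin S ->
    \sum_(l in S :|: [set k]) c l = \sum_(l in S) c l + c k.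
  by move=> kS; rewrite setUC big_setU1 //= addrC.
have local_iff (S : {set 'I_n}) (i j : 'I_n) :
    i \notin S -> j \notin S -> i != j ->
    (h a b (S :|: [set i] :|: [set j]) - h a b (S :|: [set j])
       <= h a b (S :|: [set i]) - h a b S) =
    (h a b (S :|: [set i]) + h a b (S :|: [set j]) <=
       a i / b (lift ord0 i) + a j / b (lift ord0 j)).
  move=> iS jS ij.
  have jSi : j \notin S :|: [set i] by rewrite !inE negb_or jS eq_sym.
  (* The term [b ord0] keeps this denominator positive even when [S] is empty. *)
  have B0 : 0 < b ord0 + \sum_(l in S) b (lift ord0 l).
    by rewrite ltr_wpDr // sumr_ge0 // => l _; exact: ltW.
  (* With each inequality written as nonnegativity of a difference, the two differ by a positive
     factor, which cancels. *)
  rewrite -subr_ge0 -[RHS]subr_ge0 /h !sumU1 // !addrA.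
  rewrite ratio_second_difference // pmulr_rge0 //.
  by rewrite divr_gt0 // mulr_gt0 // addr_gt0 // addr_gt0.
rewrite (submodular_over_local _ _ _ _ hF).
by split=> H S i j iS jS ij SijF; move: (H S i j iS jS ij SijF);
  rewrite (local_iff S i j iS jS ij).
Qed.
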